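(* Let $a$ be a positive integer and $b$ a non-negative integer, and let $G\in\mathscr{G}_{a,b}$. Let $C=u_1u_2\cdots u_ku_1$ be a cycle of $G$. If $d_{G_0}(u_1)\geq 3$ and $d_{G_0}(u_2)=2$, then there is $i\in\{1,2,\ldots,k\}$ such that $d(u_i)\neq a-b-1$.
   Context: Graphs are finite, simple and connected; $d(v)$ denotes the degree of $v$ in $G$, $N_G(v)$ its neighbourhood, and $s(v)=\sum_{u\in N_G(v)}d(u)$. A graph $G$ is 2-walk $(a,b)$-parabolic if there exist uniquely a positive integer $a$ and a non-negative integer $b$ such that $a^2-8b>0$ and $s(v)=-d(v)^2+a\,d(v)-b$ for all $v\in V(G)$. A bicyclic graph is a simple connected graph with number of edges equal to number of vertices plus one. $\mathscr{G}_{a,b}$ is the set of 2-walk $(a,b)$-parabolic bicyclic graphs $G$ with minimum degree $\delta(G)=1$. For $G\in\mathscr{G}_{a,b}$, $G_0$ denotes the graph obtained from $G$ by deleting all pendant (degree-1) vertices, and $d_{G_0}(v)$ the degree of $v$ in $G_0$. *)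

(* Defs.v *)
From HB Require Import structures.
From mathcomp Require Import all_boot all_order all_algebra.

Set Implicit Arguments.
Unset Strict Implicit.
Unset Printing Implicit Defensive.

Import GRing.Theory Num.Theory.
Local Open Scope ring_scope.

Record sgraph := SGraph {
  vertex :> finType;
  adj : rel vertex;
  adj_sym : symmetric adj;
  adj_irr : irreflexive adj }.

Arguments adj {G} x y : rename.

Definition nbh (G : sgraph) (v : G) : {set G} := [set u | adj v u].

Definition deg (G : sgraph) (v : G) : nat := #|nbh v|.

Definition nbh_deg_sum (G : sgraph) (v : G) : nat := (\sum_(u in nbh v) deg u)%N.

Definition edges (G : sgraph) : {set {set G}} :=
  [set [set p.1; p.2] | p : G * G & adj p.1 p.2].

Definition connected_graph (G : sgraph) : Prop :=
  forall x y : G, connect adj x y.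

Definition bicyclic (G : sgraph) : Prop :=
  connected_graph G /\ #|edges G| = #|G|.+1.

Definition is_min_degree (G : sgraph) (d : nat) : Prop :=
  (exists v : G, deg v = d) /\ (forall v : G, (d <= deg v)%N).

Definition parabolic_pair (G : sgraph) (ab : nat * nat) : Prop :=
  let: (a, b) := ab in
  [/\ (0 < a)%N,
      a%:Z ^+ 2 - 8 * b%:Z > 0
    & forall v : G,
        (nbh_deg_sum v)%:Z = - (deg v)%:Z ^+ 2 + a%:Z * (deg v)%:Z - b%:Z].

(* Uniqueness is that of the pair (a, b), among all admissible pairs. *)
Definition two_walk_parabolic (a b : nat) (G : sgraph) : Prop :=
  unique (parabolic_pair G) (a, b).

(* The class of graphs written \mathscr{G}_{a,b}. *)
Definition parabolic_bicyclic (a b : nat) (G : sgraph) : Prop :=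
  [/\ two_walk_parabolic a b G, bicyclic G & is_min_degree G 1].

Definition induced_adj (G : sgraph) (S : {set G}) : rel {x : G | x \in S} :=
  fun x y => adj (val x) (val y).

Fact induced_adj_sym (G : sgraph) (S : {set G}) : symmetric (@induced_adj G S).
Proof. by move=> x y; apply: adj_sym. Qed.

Fact induced_adj_irr (G : sgraph) (S : {set G}) :
  irreflexive (@induced_adj G S).
Proof. by move=> x; apply: adj_irr. Qed.

Definition induced (G : sgraph) (S : {set G}) : sgraph :=
  SGraph (@induced_adj_sym G S) (@induced_adj_irr G S).

(* The graph G_0; its vertices map to those of G by [val]. *)
Definition pendant_deleted (G : sgraph) : sgraph :=
  induced [set v : G | deg v != 1%N].

(* [ucycle] admits closed walks of length 1 and 2, hence the size bound. *)
Definition graph_cycle (G : sgraph) (c : seq G) : Prop :=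
  (2 < size c)%N /\ ucycle adj c.

(* Main.v *)
Require Import Defs.
From HB Require Import structures.
From mathcomp Require Import all_boot all_order all_algebra.
From mathcomp Require Import zify.

Set Implicit Arguments.
Unset Strict Implicit.
Unset Printing Implicit Defensive.

Import GRing.Theory Num.Theory.
Local Open Scope ring_scope.

(** Suppose all vertices of the cycle have degree [D = a - b - 1]. Then [u1]
    and [u2] have equal degree, so the parabolic equation gives
    [s(u1) = s(u2)]. Each of them has two cycle neighbours, of degree [D], and
    [D - 2] further neighbours. Those of [u2] are all pendant, so
    [s(u2) = 2 D + (D - 2)]; but [u1] has a non-pendant one, so
    [s(u1) > 2 D + (D - 2)]. *)

(** Counts degrees in $G_0$ while staying inside [G], away from the subtype that carries
    [pendant_deleted G]. *)
Definition nonpendant_nbh (G : sgraph) (v : G) : {set G} :=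
  [set u in nbh v | deg u != 1%N].

Lemma deg_pendant_deleted (G : sgraph) (x : pendant_deleted G) :
  deg x = #|nonpendant_nbh (sval x)|.
Proof.
rewrite /deg -(card_imset _ val_inj); apply: eq_card => u.
apply/imsetP/idP => [[y]|].
  move=> + ->; rewrite !inE => xy; apply/andP; split=> //.
  by have := valP y; rewrite inE.
rewrite !inE => /andP[vu du].
have u_in : u \in [set v : G | deg v != 1%N] by rewrite inE.
by exists (Sub u u_in : pendant_deleted G); rewrite // inE.
Qed.

Lemma deg_pendant_deleted_le (G : sgraph) (x : pendant_deleted G) :
  (deg x <= deg (sval x))%N.
Proof.
rewrite deg_pendant_deleted; apply: subset_leq_card.
by apply/subsetP => u; rewrite inE => /andP[].
Qed.

(** Each of the [deg v - 2] neighbours other than [x] and [y] contributes at least 1 to the sum.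
    Equality means that all of them are pendant, so that [x] and [y] are the only non-pendant
    neighbours. *)
Lemma nbh_deg_sum_leqif (G : sgraph) (v x y : G) :
    (forall u : G, 0 < deg u)%N -> x != y ->
    x \in nonpendant_nbh v -> y \in nonpendant_nbh v ->
  (deg v + deg x + deg y <= nbh_deg_sum v + 2
     ?= iff (#|nonpendant_nbh v| == 2))%N.
Proof.
move=> deg_gt0 nxy xN yN.
have [vx vy] : x \in nbh v /\ y \in nbh v.
  by move: xN yN; rewrite !inE => /andP[-> _] /andP[-> _].
pose R := nbh v :\ x :\ y.
have yNx : y \in nbh v :\ x by rewrite in_setD1 eq_sym nxy.
have degE : deg v = (#|R| + 2)%N.
  by rewrite /deg (cardsD1 x) vx (cardsD1 y (_ :\ x)) yNx /R; lia.
have sumE : nbh_deg_sum v = (deg x + deg y + \sum_(u in R) deg u)%N.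
  rewrite /nbh_deg_sum (big_setD1 x) //= (big_setD1 y) //=.
  by rewrite addnA.
(* The right-hand side has the shape of the equality condition that [leqif_sum] produces when [1] is
   compared with [deg u] termwise. *)
have pendantP : (#|nonpendant_nbh v| == 2) =
    [forall (u | u \in R), 1 == deg u]%N.
  rewrite (cardsD1 x) xN (cardsD1 y) in_setD1 (eq_sym y) nxy yN /= !eqSS cards_eq0.
  apply/eqP/forall_inP => [N0 u uR | R1].
    apply: contraTT uR; rewrite eq_sym => du.
    have : u \notin (nonpendant_nbh v :\ x) :\ y by rewrite N0 inE.
    by rewrite !inE du andbT.
  apply/setP => u; rewrite in_set0; apply/negP; rewrite !inE.
  move=> /and4P[uy ux vu]; rewrite eq_sym => /negP; apply; apply: R1.
  by rewrite !inE uy ux.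
have [le1 eq1] : (#|R| <= \sum_(u in R) deg u
    ?= iff (#|nonpendant_nbh v| == 2))%N.
  rewrite pendantP -sum1_card.
  by apply: leqif_sum => u _; apply: leqif_eq.
by rewrite degE sumE; split; [lia | rewrite -eq1; apply/eqP/eqP; lia].
Qed.

Lemma parabolic_nbh_deg_sum (a b : nat) (G : sgraph) (u v : G) :
  parabolic_pair G (a, b) -> deg u = deg v -> nbh_deg_sum u = nbh_deg_sum v.
Proof. by case=> _ _ sE duv; have := sE u; rewrite duv -sE => -[]. Qed.

Theorem lemma4 (a b : nat) (ha : (0 < a)%N) (G : sgraph)
  (hG : parabolic_bicyclic a b G)
  (u1 u2 : G) (p : seq G)
  (hC : graph_cycle [:: u1, u2 & p])
  (x1 x2 : pendant_deleted G)
  (hx1 : sval x1 = u1) (hx2 : sval x2 = u2)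
  (hd1 : (3 <= deg x1)%N) (hd2 : deg x2 = 2%N) :
  exists2 u : G, u \in [:: u1, u2 & p] & (deg u)%:Z <> a%:Z - b%:Z - 1.
Proof.
case: hG => -[parG _] _ [_ deg_gt0].
have [/hasP[u uC /eqP du]|/hasPn degC] :=
  boolP (has (fun u : G => (deg u)%:Z != a%:Z - b%:Z - 1) [:: u1, u2 & p]).
  by exists u.
have degE u : u \in [:: u1, u2 & p] -> deg u = deg u1.
  move=> uC; have /negPn/eqP d1 := degC u1 (mem_head _ _).
  by have /negPn/eqP := degC u uC; rewrite -d1 => -[].
have deg1_ge3 : (3 <= deg u1)%N.
  by rewrite -hx1 (leq_trans hd1) ?deg_pendant_deleted_le.
(* The size bound provides [u3]. On the cycle, [u1] lies between [last u3 q] and [u2], and [u2]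
   between [u1] and [u3]; in a triangle [q] is empty and [last u3 q] is [u3]. *)
case: p hC {degC} degE => [[]//|u3 q] [_ /andP[cyc uniqC]] degE.
have [adj12 adj23 adjl1] : [/\ adj u1 u2, adj u2 u3 & adj (last u3 q) u1].
  by move: cyc; rewrite /= rcons_path => /and4P[].
have nonpendantC u v : u \in [:: u1, u2, u3 & q] -> adj v u ->
    u \in nonpendant_nbh v.
  by move=> uC vu; rewrite !inE vu degE //=; lia.
have lC : last u3 q \in [:: u1, u2, u3 & q].
  by rewrite !inE -in_cons mem_last !orbT.
have u2C : u2 \in [:: u1, u2, u3 & q] by rewrite !inE eqxx orbT.
have u3C : u3 \in [:: u1, u2, u3 & q] by rewrite !inE eqxx !orbT.
have n13 : u1 != u3.
  by move: uniqC => /andP[]; rewrite !inE !negb_or => /and3P[].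
have n2l : u2 != last u3 q.
  by move: uniqC => /and3P[_ + _]; apply: contraNneq => ->; apply: mem_last.
have [le1 eq1] := nbh_deg_sum_leqif deg_gt0 n2l
  (nonpendantC _ _ u2C adj12) (nonpendantC _ _ lC (etrans (adj_sym _ _) adjl1)).
have [le2 eq2] := nbh_deg_sum_leqif deg_gt0 n13
  (nonpendantC _ _ (mem_head _ _) (etrans (adj_sym _ _) adj12))
  (nonpendantC _ _ u3C adj23).
(* Once degrees and neighbour sums are identified, both equality cases compare the same two numbers.
   Equality holds at [u2] since [deg x2 = 2], so at [u1] it would force [deg x1 = 2], against
   [hd1]. *)
move: eq1 eq2; rewrite -hx1 -hx2 -!deg_pendant_deleted hd2 hx1 hx2.
rewrite (parabolic_nbh_deg_sum parG (degE _ u2C))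
  !(degE _ u2C, degE _ u3C, degE _ lC).
by lia.
Qed.
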